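(* Let $\alpha>0$, $\theta\in\mathbb{R}$ and $-\infty<\beta<1$, and let $\Gamma_{\alpha,\theta}=\{n^\alpha e^{2\pi n\theta\sqrt{-1}} \mid n\in\mathbb{Z}_{\ge 0}\}\subset\mathbb{C}$. If $\Gamma_{\alpha,\theta}$ is asymptotically $\beta$-relatively dense, then $1+2\alpha\beta\ge 2\alpha$.
   Context: For a point set $\Gamma\subset\mathbb{C}$ put $\Gamma'=\{\gamma\in\Gamma \mid |\gamma|\ge 1\}$. For $-\infty<\beta<1$, $\Gamma$ is called asymptotically $\beta$-relatively dense if there exists $r>0$ satisfying one (equivalently, all) of the following three conditions, which are mutually equivalent for each fixed $r$: (i) for any $r_1>r$ there exists $M_1>0$ such that for any $z\in\mathbb{C}$ with $|z|\ge M_1$ there exists $\zeta\in\Gamma'$ with $|z-\zeta|<r_1|z|^\beta$; (ii) for any $r_2>r$ there exists $M_2>0$ such that for any $z\in\mathbb{C}$ with $|z|\ge M_2$ there exists $\zeta\in\Gamma'$ with $|z-\zeta|<r_2|\zeta|^\beta$; (iii) for any $r_3>r$ there exists $M_3>0$ such that for any $z\in\mathbb{C}$ with $|z|\ge M_3$ there exists $\zeta\in\Gamma'$ with $|z-\zeta|<\frac{r_3}{2}(|z|^\beta+|\zeta|^\beta)$. *)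

(* Defs.v *)
From mathcomp Require Import all_boot all_order all_algebra.
From mathcomp Require Import all_classical all_reals all_analysis.
From mathcomp Require Import complex.

Set Implicit Arguments.
Unset Strict Implicit.
Unset Printing Implicit Defensive.

Import Order.TTheory GRing.Theory Num.Theory.

Local Open Scope classical_set_scope.
Local Open Scope ring_scope.
Local Open Scope complex_scope.

(* The norm `|z| of MathComp takes its values in R[i]; the real-valued modulus
   is needed here because it is raised to real powers. *)
Notation cmod := ComplexField.Normc.normc.

Definition expi (R : realType) (t : R) : R[i] := cos t +i* sin t.

(* For n = 0 the point is 0, since powR satisfies 0 `^ alpha = 0 for every
   alpha != 0. *)
Definition spiral (R : realType) (alpha theta : R) : set R[i] :=
  [set z | exists n : nat,
     z = (n%:R `^ alpha)%:C * expi (2 * pi * n%:R * theta)].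

Definition outside_disk (R : realType) (G : set R[i]) : set R[i] :=
  [set z | G z /\ 1 <= cmod z].

Definition rel_dense_center (R : realType) (beta : R) (G : set R[i]) (r : R) :=
  forall r1 : R, r < r1 -> exists2 M1 : R, 0 < M1 &
    forall z : R[i], M1 <= cmod z ->
      exists2 zeta : R[i], outside_disk G zeta &
        cmod (z - zeta) < r1 * cmod z `^ beta.

Definition rel_dense_point (R : realType) (beta : R) (G : set R[i]) (r : R) :=
  forall r2 : R, r < r2 -> exists2 M2 : R, 0 < M2 &
    forall z : R[i], M2 <= cmod z ->
      exists2 zeta : R[i], outside_disk G zeta &
        cmod (z - zeta) < r2 * cmod zeta `^ beta.

Definition rel_dense_mean (R : realType) (beta : R) (G : set R[i]) (r : R) :=
  forall r3 : R, r < r3 -> exists2 M3 : R, 0 < M3 &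
    forall z : R[i], M3 <= cmod z ->
      exists2 zeta : R[i], outside_disk G zeta &
        cmod (z - zeta) < r3 / 2 * (cmod z `^ beta + cmod zeta `^ beta).

(* For beta < 1 and fixed r > 0 the three conditions are equivalent, so that
   requiring one of them amounts to requiring all of them. *)
Definition asymptotically_relatively_dense (R : realType) (beta : R)
    (G : set R[i]) :=
  exists2 r : R, 0 < r &
    [\/ rel_dense_center beta G r, rel_dense_point beta G r
      | rel_dense_mean beta G r].

(* Main.v *)
Require Import Defs.
From mathcomp Require Import all_boot all_order all_algebra.
From mathcomp Require Import all_classical all_reals all_analysis.
From mathcomp Require Import complex.
From mathcomp Require Import ring lra.

Set Implicit Arguments.
Unset Strict Implicit.
Unset Printing Implicit Defensive.

Import Order.TTheory GRing.Theory Num.Theory.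
Local Open Scope ring_scope.

(** The proof is an area count.  Density says that every [z] of large modulus
    lies within [O(|z| ^ beta)] of the spiral.  At scale [rho] this makes discs
    of radius [A * rho ^ beta], centred at points of the spiral of modulus at
    most [6 * rho], cover the annulus [rho <= |z| <= 3 * rho].  The spiral has
    [O(rho ^ (1 / alpha))] such points, the angles being irrelevant because the
    [n]-th point has modulus [n ^ alpha].  Comparing areas,
    [rho ^ 2 <= D * rho ^ (1 / alpha) * rho ^ (2 * beta)] for all large [rho],
    hence [2 <= 1 / alpha + 2 * beta].

    The areas are compared by the pigeonhole principle: a square grid in the
    annulus whose mesh is the diameter of the discs has at most one node in each
    disc ([covering_card]).  The three forms of density are first brought to a
    common one in [dense_sum]; [dense_at_scale] then turns the radius into a
    multiple of [rho ^ beta], where the hypothesis [beta < 1] guarantees that a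
    spiral point close to [z] has modulus comparable to [|z|]. *)

(** * Growth of real powers *)

Section RealPowers.
Variable R : realType.
Implicit Types (x y b c k e D M : R).

Lemma le_powR b x y : 0 <= b -> 0 <= x -> x <= y -> x `^ b <= y `^ b.
Proof.
move=> b0 x0 xy.
by rewrite ge0_ler_powR // nnegrE // (le_trans x0 xy).
Qed.

Lemma powRK e x : 0 < e -> 0 <= x -> (x `^ e) `^ e^-1 = x.
Proof. by move=> e0 x0; rewrite -powRrM divff ?lt0r_neq0 ?powRr1. Qed.

(** The norm of the exponent lets one bound serve for both signs of [b]: for
    [b >= 0] it comes from [y <= k * x], for [b < 0] from [x <= k * y]. *)
Lemma powR_comparable b k x y : 0 < k -> 0 < x -> 0 < y ->
  x <= k * y -> y <= k * x -> y `^ b <= k `^ `|b| * x `^ b.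
Proof.
move=> k0 x0 y0 xy yx; have [b0|b0] := leP 0 b.
  rewrite ger0_norm // -powRM ?(ltW k0) ?(ltW x0) //.
  exact: le_powR b0 (ltW y0) yx.
have b_ge0 : 0 <= - b by rewrite oppr_ge0 ltW.
rewrite ltr0_norm // -{1 3}[b]opprK (powRN y) (powRN x).
rewrite ler_pdivlMr ?powR_gt0 // mulrC ler_pdivrMr ?powR_gt0 //.
by rewrite -powRM ?(ltW k0) ?(ltW y0) //; apply: le_powR b_ge0 (ltW x0) xy.
Qed.

Lemma powR_gt_any e D M : 0 < e -> exists2 x : R, M <= x /\ 1 <= x & D < x `^ e.
Proof.
move=> e0; exists (1 + `|M| + (1 + `|D|) `^ e^-1).
  have := powR_ge0 (1 + `|D|) e^-1; have := ler_norm M; have := normr_ge0 M.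
  by move=> *; split; lra.
have pD := powR_ge0 (1 + `|D|) e^-1.
have D1 : 0 <= 1 + `|D| by rewrite addr_ge0.
have lt_D : D < 1 + `|D| by have := ler_norm D; lra.
apply: lt_le_trans lt_D _.
rewrite -[leLHS](powRK e0 D1) powRAC.
have := normr_ge0 M => M0.
by apply: le_powR; lra.
Qed.

(** The ratio [x `^ b / x] tends to [0], so the bound holds with no constant
    beyond some threshold [T]; up to [T], the crude [x `^ b <= x] bounds the
    left-hand side by [c * T]. *)
Lemma powR_sublinear b c : b < 1 -> 0 < c ->
  exists K : R, forall x, 1 <= x -> c * x `^ b <= x / 4 + K.
Proof.
move=> b1 c0; have e0 : 0 < 1 - b by lra.
have [T [_ T1] cT] := powR_gt_any (4 * c) 0 e0.
exists (c * T) => x x1.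
have x0 : 0 < x by lra.
have cT0 : 0 < c * T by rewrite mulr_gt0 //; lra.
have [xT|Tx] := leP x T.
  have : c * x `^ b <= c * T.
    by rewrite ler_pM2l // (le_trans (ler1_powR x1 (ltW b1))).
  lra.
have cx : 4 * c < x `^ (1 - b).
  apply: lt_le_trans cT _.
  by apply: le_powR; lra.
have xE : x = x `^ (1 - b) * x `^ b.
  by rewrite -powRD ?subrK ?powRr1 ?gt_eqF ?implybT // ltW.
have : 4 * c * x `^ b < x.
  by rewrite [ltRHS]xE ltr_pM2r ?powR_gt0.
lra.
Qed.

End RealPowers.

(** * The complex modulus *)

Section Modulus.
Variable R : realType.
Implicit Types (z w : R[i]) (a b x y : R).
Local Open Scope complex_scope.

Lemma cmod_distC z w : cmod (z - w) = cmod (w - z).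
Proof. by rewrite -opprB (@normcN R (w - z)). Qed.

Lemma cmod_triangle z w u : cmod (z - w) <= cmod (z - u) + cmod (u - w).
Proof. by rewrite -[z - w](subrKA u z (- w)) (@le_normcD R). Qed.

Lemma cmod_dist z w : cmod z <= cmod w + cmod (z - w).
Proof. by rewrite -[z in leLHS](subrK w) addrC (@le_normcD R w). Qed.

Lemma le_Re_cmod a b : `|a| <= cmod (a +i* b).
Proof. by rewrite /= -sqrtr_sqr ler_wsqrtr // lerDl sqr_ge0. Qed.

Lemma le_Im_cmod a b : `|b| <= cmod (a +i* b).
Proof. by rewrite /= -sqrtr_sqr ler_wsqrtr // lerDr sqr_ge0. Qed.

Lemma cmod_le_sum a b : cmod (a +i* b) <= `|a| + `|b|.
Proof.
rewrite -[leRHS]ger0_norm ?addr_ge0 // -sqrtr_sqr /= ler_wsqrtr //.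
rewrite sqrrD !real_normK ?num_real //.
have : 0 <= `|a| * `|b| by rewrite mulr_ge0.
lra.
Qed.

Lemma cmod_real_expi x t : 0 <= x -> cmod (x%:C * expi t) = x.
Proof.
move=> x0; rewrite Normc.normcM /= cos2Dsin2 sqrtr1 mulr1.
by rewrite expr0n addr0 sqrtr_sqr ger0_norm.
Qed.

End Modulus.

(** * Counting the discs of a covering *)

Section Covering.
Variable R : realType.
Local Open Scope complex_scope.

(** The grid of mesh [2 * d] with corner [rho] and side at most [rho] lies in
    the annulus and has at least [(rho / (2 * d)) ^+ 2] nodes, no two of which
    are within [d] of the same point. *)
Lemma covering_card (p : nat -> R[i]) (P : nat) (rho d : R) :
  0 < rho -> 0 < d ->
  (forall z : R[i], rho <= cmod z <= 3 * rho ->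
     exists2 n, (n < P)%N & cmod (z - p n) < d) ->
  (rho / (2 * d)) ^+ 2 <= P%:R.
Proof.
move=> rho0 d0 cover; set q := rho / (2 * d).
have q0 : 0 <= q by rewrite divr_ge0 // ltW // mulr_gt0.
pose N := (Num.truncn q).+1.
pose node (jk : 'I_N * 'I_N) : R[i] :=
  (rho + 2 * d * jk.1%:R) +i* (2 * d * jk.2%:R).
have side (j : 'I_N) : 0 <= 2 * d * j%:R <= rho.
  rewrite !mulr_ge0 //; last exact: ltW.
  rewrite mulrC -ler_pdivlMr ?mulr_gt0 //.
  by rewrite -truncn_ge_nat // -ltnS ltn_ord.
have node_annulus jk : rho <= cmod (node jk) <= 3 * rho.
  have /andP[j0 j1] := side jk.1; have /andP[k0 k1] := side jk.2.
  apply/andP; split.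
    by apply: le_trans (le_Re_cmod _ _); rewrite ger0_norm; lra.
  by apply: le_trans (cmod_le_sum _ _) _; rewrite !ger0_norm; lra.
have /fin_all_exists[f fP] (jk : 'I_N * 'I_N) :
    exists n : 'I_P, cmod (node jk - p n) < d.
  have [n nP nd] := cover _ (node_annulus jk).
  by exists (Ordinal nP).
(* Distinct nodes differ by at least the mesh in one of their coordinates. *)
have mesh (i j : nat) : `|2 * d * i%:R - 2 * d * j%:R| < 2 * d -> i = j.
  rewrite -mulrBr normrM gtr0_norm ?mulr_gt0 // gtr_pMr ?mulr_gt0 //.
  move=> lt1; apply/eqP.
  rewrite eqn_leq -(ltnS i) -(ltnS j) -!(ltr_nat R) -!natr1.
  by move: lt1; rewrite ltr_norml => /andP[? ?]; apply/andP; split; lra.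
have inj_f : injective f.
  move=> [j k] [j' k'] eq_f.
  have near : cmod (node (j, k) - node (j', k')) < 2 * d.
    apply: le_lt_trans (cmod_triangle _ _ (p (f (j, k)))) _.
    have := fP (j, k); have := fP (j', k').
    by rewrite -eq_f (cmod_distC (node (j', k'))) => *; lra.
  congr (_, _); apply/val_inj/mesh.
    apply: le_lt_trans near; apply: le_trans _ (le_Re_cmod _ _).
    by rewrite /= opprD addrACA subrr add0r.
  by apply: le_lt_trans near; apply: le_trans _ (le_Im_cmod _ _).
have := leq_card f inj_f; rewrite card_prod !card_ord => NP.
apply: (@le_trans _ _ (N * N)%:R); last by rewrite ler_nat.
have qN : q <= N%:R by rewrite ltW // truncnS_gt.
by rewrite natrM expr2 ler_pM.
Qed.

End Covering.

(** * Density at a given scale *)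

Section Density.
Variable R : realType.
Implicit Types (beta : R) (G : set R[i]).

(** Each of the three radii of the definition is at most a multiple of
    [cmod z `^ beta + cmod zeta `^ beta], so the rest of the argument can treat
    them together. *)
Lemma dense_sum beta G : asymptotically_relatively_dense beta G ->
  exists C M : R, [/\ 0 < C, 0 < M & forall z : R[i], M <= cmod z ->
    exists2 zeta, outside_disk G zeta &
      cmod (z - zeta) < C * (cmod z `^ beta + cmod zeta `^ beta)].
Proof.
move=> [r r0 dense]; exists (r + 1); have rr : r < r + 1 by lra.
have C0 : 0 < r + 1 by lra.
have weaken (a b s : R) : 0 <= a -> 0 <= b ->
    [\/ s < (r + 1) * a, s < (r + 1) * b | s < (r + 1) / 2 * (a + b)] ->
    s < (r + 1) * (a + b).
  move=> a0 b0; have : 0 <= (r + 1) * a by rewrite mulr_ge0 // ltW.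
  have : 0 <= (r + 1) * b by rewrite mulr_ge0 // ltW.
  by move=> ? ? [|/[!mulrDr]|] *; lra.
case: dense => /(_ _ rr)[M M0 near]; exists M; split=> // z /near[zeta Gz zd];
  exists zeta => //; apply: weaken; rewrite ?powR_ge0 //.
- by constructor 1.
- by constructor 2.
- by constructor 3.
Qed.

(** Since [beta < 1], the radius is at most a quarter of [|z| + |zeta|] plus a
    constant, so that [|z|] and [|zeta|] differ by a bounded factor; all powers
    [`^ beta] in sight are then comparable to [rho `^ beta]. *)
Lemma dense_at_scale beta G : beta < 1 ->
  asymptotically_relatively_dense beta G ->
  exists A M : R, 0 < A /\ forall rho : R, M <= rho -> 0 < rho ->
    forall z : R[i], rho <= cmod z <= 3 * rho ->
    exists2 zeta, G zeta /\ cmod zeta <= 6 * rho &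
      cmod (z - zeta) < A * rho `^ beta.
Proof.
move=> beta1 /dense_sum[C [M [C0 M0 near]]].
have [K sub] := powR_sublinear beta1 C0.
(* Moduli from [rho / 6] to [6 * rho] occur, whence [6 `^ `|beta|], once for [z]
   and once for [zeta]; the lower bound on [rho] makes [|K|] at most
   [rho / 16], which leaves room for [rho / 6 <= cmod zeta <= 6 * rho]. *)
exists (C * (2 * 6 `^ `|beta|)), (M + 16 * `|K| + 1); split.
  by rewrite !mulr_gt0 ?powR_gt0.
move=> rho Mrho rho0 z /andP[rho_z z_rho].
have K0 := normr_ge0 K; have KK := ler_norm K.
have [|zeta [Gz zeta1] zd] := near z; first by lra.
have zeta_z := cmod_dist zeta z; rewrite cmod_distC in zeta_z.
have z_zeta := cmod_dist z zeta.
have bz : C * cmod z `^ beta <= cmod z / 4 + K by apply: sub; lra.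
have bzeta := sub _ zeta1.
rewrite mulrDr in zd.
have zeta_le : cmod zeta <= 6 * rho by lra.
have zeta_ge : rho <= 6 * cmod zeta by lra.
exists zeta => //; apply: lt_le_trans zd _.
have bound (x : R) : rho <= 6 * x -> 0 < x -> x <= 6 * rho ->
    x `^ beta <= 6 `^ `|beta| * rho `^ beta.
  by move=> *; apply: powR_comparable.
rewrite -mulrDr -!mulrA ler_pM2l // mulr_natl mulr2n lerD //; apply: bound; lra.
Qed.

End Density.

(** * The exponent inequality *)

Lemma spiral_index_bound (R : realType) (alpha theta B : R) (n : nat) :
  0 < alpha ->
  cmod ((n%:R `^ alpha)%:C * expi (2 * pi * n%:R * theta))%C <= B ->
  (n < (Num.truncn (B `^ alpha^-1)).+1)%N.
Proof.
move=> alpha0; rewrite cmod_real_expi ?powR_ge0 // => nB.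
rewrite ltnS truncn_ge_nat ?powR_ge0 //.
rewrite -[leLHS](powRK alpha0 (ler0n _ _)).
by apply: le_powR; rewrite ?powR_ge0 ?invr_ge0 ?(ltW alpha0).
Qed.

Theorem lemma1 (R : realType) (alpha theta beta : R) (alpha_gt0 : 0 < alpha)
    (beta_lt1 : beta < 1)
    (dense : asymptotically_relatively_dense beta (spiral alpha theta)) :
  1 + 2 * alpha * beta >= 2 * alpha.
Proof.
have [A [M [A0 near]]] := dense_at_scale beta_lt1 dense.
(* [e] is the exponent by which the area of the annulus outgrows the total area
   of the discs. *)
pose e := 2 - 2 * beta - alpha^-1.
have [e_le0|e_gt0] := leP e 0.
  have : alpha * e <= 0 by rewrite pmulr_rle0.
  by rewrite /e !mulrBr divff ?gt_eqF // => ?; lra.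
pose D := 8 * A ^+ 2 * 6 `^ alpha^-1.
have [rho [Mrho rho1] Drho] := powR_gt_any D M e_gt0.
have rho0 : 0 < rho by lra.
have b0 : 0 < rho `^ beta by rewrite powR_gt0.
pose P := (Num.truncn ((6 * rho) `^ alpha^-1)).+1.
pose p n : R[i] := ((n%:R `^ alpha)%:C * expi (2 * pi * n%:R * theta))%C.
have card_le : (rho / (2 * (A * rho `^ beta))) ^+ 2 <= P%:R.
  apply: (covering_card (p := p)) => // [|z /(near _ Mrho rho0)].
    exact: mulr_gt0.
  move=> [_ [[n ->]] le_n dist_n]; exists n => //.
  exact: spiral_index_bound alpha_gt0 le_n.
have P_le : P%:R <= 2 * (6 `^ alpha^-1 * rho `^ alpha^-1).
  rewrite -powRM ?(ltW rho0) // -[leLHS]natr1 [leRHS]mulr_natl mulr2n lerD //.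
    by rewrite truncn_le powR_ge0.
  rewrite -[1 in leLHS](powRr0 (6 * rho)) ler_powR ?invr_ge0 ?ltW //; lra.
have rhoE : rho `^ e = rho ^+ 2 / (rho `^ beta) ^+ 2 / rho `^ alpha^-1.
  rewrite /e !powRB ?(gt_eqF rho0) ?implybT // powR_mulrn ?(ltW rho0) //.
  by rewrite [2 * beta]mulrC powRrM powR_mulrn ?powR_ge0.
(* Clearing denominators in the count bounds [rho `^ e] by [D], which [rho]
   was chosen to exceed. *)
suff : rho `^ e <= D by rewrite leNgt Drho.
rewrite rhoE ler_pdivrMr ?powR_gt0 //.
have := le_trans card_le P_le.
have -> : (rho / (2 * (A * rho `^ beta))) ^+ 2 =
    rho ^+ 2 / (rho `^ beta) ^+ 2 / (4 * A ^+ 2).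
  by field; rewrite !gt_eqF.
rewrite ler_pdivrMr ?mulr_gt0 ?exprn_gt0 // /D => le_rho.
by apply: le_trans le_rho _; rewrite le_eqVlt; apply/orP; left; apply/eqP; ring.
Qed.
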